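(* Let $\ell\in\mathbb{N}$ and let $v(x)$ be a real polynomial. The following are equivalent: (i) There exists a polynomial $w\in\mathbb{Q}[x]$ with $w(0)\in\mathbb{Z}$ such that $v-w$ is an odd polynomial of degree at most $2\ell-1$. (ii) For every $\epsilon>0$ there exists an integer $r\ge 2^\ell$ for which $\mathcal R(v,\epsilon)$ is a $\Delta_{\ell,r}^*$ set. (iii) For every $\epsilon>0$, $\mathcal R(v,\epsilon)$ is a $\Delta_\ell^*$ set.
   Context: $\mathbb{N}=\{1,2,\dots\}$; $\|x\|$ is the distance from $x$ to the nearest integer; $\mathcal R(v,\epsilon)=\{n\in\mathbb{N}:\|v(n)\|<\epsilon\}$. A polynomial is odd if it has the form $\sum_j a_jx^{2j-1}$ (i.e. $v(-x)=-v(x)$). Define $\partial:\bigcup_{\ell\ge1}\mathbb{Z}^{2^\ell}\to\mathbb{Z}$ recursively by $\partial(m_1,m_2)=m_2-m_1$ and $\partial(m_1,\dots,m_{2^\ell})=\partial(m_{2^{\ell-1}+1},\dots,m_{2^\ell})-\partial(m_1,\dots,m_{2^{\ell-1}})$ for $\ell>1$. For a finite or infinite sequence $(n_k)$ in $\mathbb{Z}$, $D_\ell((n_k))=\{\partial(n_{j_1},\dots,n_{j_{2^\ell}}): j_1<\dots<j_{2^\ell}\}$ (indices ranging over the index set of the sequence). For $r\ge2^\ell$, $E\subseteq\mathbb{N}$ is a $\Delta_{\ell,r}$ set if $D_\ell((n_k)_{k=1}^r)\subseteq E$ for some $r$-element sequence in $\mathbb{Z}$; $E$ is $\Delta_{\ell,r}^*$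 if it meets every $\Delta_{\ell,r}$ set. $E\subseteq\mathbb{N}$ is $\Delta_\ell^*$ if for every increasing sequence $(n_k)_{k\in\mathbb{N}}$ in $\mathbb{N}$, $E\cap D_\ell((n_k)_{k\in\mathbb{N}})\ne\emptyset$. *)

(* Defs.v *)
From HB Require Import structures.
From mathcomp Require Import all_boot all_order all_algebra.
From mathcomp Require Import all_classical all_reals.

Set Implicit Arguments.
Unset Strict Implicit.
Unset Printing Implicit Defensive.

Import Order.TTheory GRing.Theory Num.Theory.

Local Open Scope classical_set_scope.
Local Open Scope ring_scope.

(* The set {1, 2, ...}, as a set of integers: the sets D_l consist of integers,
   so all subsets of the positive naturals are handled inside int. *)
Definition posint : set int := [set n | 0 < n].

Definition dist_int (R : realType) (x : R) : R :=
  inf [set `|x - m%:~R| | m in [set: int]].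

Definition ret_set (R : realType) (v : {poly R}) (eps : R) : set int :=
  [set n | posint n /\ dist_int v.[n%:~R] < eps].

Definition odd_poly_form (R : realType) (p : {poly R}) : Prop :=
  exists (k : nat) (a : nat -> R),
    p = \sum_(1 <= j < k.+1) a j *: 'X^(2 * j - 1).

(* The operator on tuples of length 2^l, represented as sequences. Starting the
   recursion at l = 0 with the identity gives m_2 - m_1 for l = 1; see pdiff1
   and pdiffS. The value is only meaningful when size m = 2^l. *)
Fixpoint pdiff (l : nat) (m : seq int) : int :=
  if l is l'.+1 then
    pdiff l' (drop (2 ^ l') m) - pdiff l' (take (2 ^ l') m)
  else head 0 m.

Lemma pdiff1 (m1 m2 : int) : pdiff 1 [:: m1; m2] = m2 - m1.
Proof. by []. Qed.

Lemma pdiffS (l : nat) (s t : seq int) : size s = (2 ^ l)%N ->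
  pdiff l.+1 (s ++ t) = pdiff l t - pdiff l s.
Proof. by move=> sz /=; rewrite drop_size_cat // take_size_cat. Qed.

(* The index type I is 'I_r for a sequence with r terms and nat for an infinite
   sequence; strictly sorted sequences js are the choices j_1 < ... < j_{2^l}. *)
Definition Dset (d : Order.disp_t) (I : orderType d) (l : nat) (n : I -> int) :
    set int :=
  [set pdiff l (map n js) | js in
     [set js : seq I | size js = (2 ^ l)%N /\ sorted <%O js]].

Definition is_Delta (l r : nat) (E : set int) : Prop :=
  E `<=` posint /\ exists n : 'I_r -> int, Dset l n `<=` E.

Definition is_Delta_fin_star (l r : nat) (E : set int) : Prop :=
  E `<=` posint /\ forall F : set int, is_Delta l r F -> E `&` F !=set0.

Definition is_Delta_star (l : nat) (E : set int) : Prop :=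
  E `<=` posint /\
  forall n : nat -> int, (forall k, posint (n k)) ->
    {homo n : i j / (i < j)%N >-> i < j} ->
    E `&` Dset l n !=set0.

(* Main.v *)
Require Import Defs.
From HB Require Import structures.
From mathcomp Require Import all_boot all_order all_algebra.
From mathcomp Require Import all_classical all_reals.
From mathcomp Require Import ring lra zify.

Set Implicit Arguments.
Unset Strict Implicit.
Unset Printing Implicit Defensive.

Import Order.TTheory GRing.Theory Num.Theory.

Local Open Scope classical_set_scope.
Local Open Scope ring_scope.

(* Write T for the circle group R/Z and, for an ultrafilter p on a ring A, let
   D_l p be the law of the difference operator of 2^l successive choices from p.

   Sufficiency. For an additive map chi : A -> T and an odd exponent e <= 2l - 1
   the limit of chi(x^e) along D_l p is 0, by induction on l: expand (y - x)^e,
   where the pure terms cancel, while in each mixed term one of the exponents is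
   odd and at most e - 2. Applied to the ring A of integer sequences, this gives a
   bound r that is uniform over all finite sequences of integers.

   Necessity. Suppose (iii). For an ultrafilter p on the integers containing all
   half-lines and all ideals, put tau_e(c) = lim_p c n^e, an endomorphism of T. A
   Ramsey argument shows that the limit of v along D_l p is 0 for each such p, and
   this limit is a polynomial in the tau_e. Such ultrafilters form a semigroup, in
   which commutators realise every prescribed value of tau_e(g) at a non-torsion
   point g with all lower tau vanishing identically. The resulting choices of p
   force the constant coefficient of v to vanish in T, then the other even
   coefficients to be torsion, and finally also the odd ones of degree above
   2l - 1, whose contribution to the limit along D_l p has as lowest term an
   l-fold commutator of tau_2 with an odd tau. *)

(** * The circle group *)

Definition frac (R : realType) (x : R) : R := x - (Num.floor x)%:~R.

Lemma frac_itv (R : realType) (x : R) : (0 <= frac x) && (frac x < 1).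
Proof.
by rewrite /frac subr_ge0 floor_le ltrBlDr addrC -[1]/(1%:~R) -intrD floorD1_gt.
Qed.

Lemma fracDz (R : realType) (x : R) (m : int) : frac (x + m%:~R) = frac x.
Proof. by rewrite /frac floorDrz ?intr_int // intrKfloor intrD; ring. Qed.

Lemma frac_id (R : realType) (x : R) : 0 <= x < 1 -> frac x = x.
Proof.
move=> x01; rewrite /frac; suff -> : Num.floor x = 0 by rewrite subr0.
by apply: floor_def; rewrite add0r.
Qed.

(** A class of R/Z is stored by its representative in [0, 1), so that equality in the circle is
    plain equality. *)
Record circle (R : realType) := Circle {
  cval : R;
  _ : (0 <= cval) && (cval < 1) }.

HB.instance Definition _ (R : realType) := [isSub for @cval R].
HB.instance Definition _ (R : realType) := [Choice of circle R by <:].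

Definition tor (R : realType) (x : R) : circle R := Circle (frac_itv x).

Lemma torDz (R : realType) (x : R) (m : int) : tor (x + m%:~R) = tor x.
Proof. by apply: val_inj; rewrite /= fracDz. Qed.

Lemma tor_cval (R : realType) (t : circle R) : tor (cval t) = t.
Proof. by case: t => x x01; apply: val_inj; rewrite /= frac_id. Qed.

Lemma tor_eq (R : realType) (x y : R) :
  tor x = tor y <-> exists m : int, x = y + m%:~R.
Proof.
split=> [/(congr1 (@cval R)) /= /eqP|[m ->]]; last by rewrite torDz.
rewrite /frac => /eqP e; exists (Num.floor x - Num.floor y).
by rewrite intrB; lra.
Qed.

Definition circle_add (R : realType) (s t : circle R) := tor (cval s + cval t).
Definition circle_opp (R : realType) (t : circle R) := tor (- cval t).

Lemma tor_addE (R : realType) (x y : R) :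
  circle_add (tor x) (tor y) = tor (x + y).
Proof.
apply/tor_eq; exists (- Num.floor x - Num.floor y).
by rewrite /= /frac intrB intrN; ring.
Qed.

Lemma tor_oppE (R : realType) (x : R) : circle_opp (tor x) = tor (- x).
Proof. by apply/tor_eq; exists (Num.floor x); rewrite /= /frac; ring. Qed.

Lemma circle_addA (R : realType) : associative (@circle_add R).
Proof.
move=> s t u; rewrite -[s]tor_cval -[t]tor_cval -[u]tor_cval.
by rewrite !tor_addE addrA.
Qed.

Lemma circle_addC (R : realType) : commutative (@circle_add R).
Proof. by move=> s t; rewrite /circle_add addrC. Qed.

Lemma circle_add0 (R : realType) : left_id (tor 0) (@circle_add R).
Proof. by move=> t; rewrite -[t]tor_cval tor_addE add0r. Qed.

Lemma circle_addN (R : realType) :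
  left_inverse (tor 0) (@circle_opp R) (@circle_add R).
Proof. by move=> t; rewrite -[t]tor_cval tor_oppE tor_addE addNr. Qed.

HB.instance Definition _ (R : realType) := GRing.isZmodule.Build (circle R)
  (@circle_addA R) (@circle_addC R) (@circle_add0 R) (@circle_addN R).

Lemma torB (R : realType) : zmod_morphism (@tor R).
Proof.
by move=> x y; rewrite -tor_addE -tor_oppE.
Qed.

HB.instance Definition _ (R : realType) :=
  GRing.isZmodMorphism.Build R (circle R) (@tor R) (@torB R).

Lemma tor_eq0 (R : realType) (x : R) :
  tor x = 0 <-> exists m : int, x = m%:~R.
Proof.
rewrite -(raddf0 (@tor R)); split=> [/tor_eq [m ->]|[m ->]].
  by exists m; rewrite add0r.
by rewrite -[X in tor X]add0r torDz.
Qed.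

Lemma tor_mulz (R : realType) (x : R) (m : int) : tor x *~ m = tor (x * m%:~R).
Proof. by rewrite mulrzr raddfMz. Qed.

(** A bound on the distance to 0 in R/Z; leaving the representative free makes sums and opposites
    immediate. *)
Definition small (R : realType) (d : R) (t : circle R) : Prop :=
  exists2 x, t = tor x & `|x| < d.

Lemma small0 (R : realType) (d : R) : 0 < d -> small d (0 : circle R).
Proof. by move=> d0; exists 0; rewrite ?normr0 // raddf0. Qed.

Lemma smallD (R : realType) (d e : R) (s t : circle R) :
  small d s -> small e t -> small (d + e) (s + t).
Proof.
move=> [x -> xd] [y -> ye]; exists (x + y); first by rewrite raddfD.
by rewrite (le_lt_trans (ler_normD _ _)) // ltrD.
Qed.

Lemma smallN (R : realType) (d : R) (t : circle R) : small d t -> small d (- t).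
Proof. by move=> [x -> xd]; exists (- x); rewrite ?normrN // raddfN. Qed.

Lemma small_half (R : realType) (d : R) (s t : circle R) :
  small (d / 2) s -> small (d / 2) t -> small d (s + t).
Proof. by move=> hs ht; have := smallD hs ht; rewrite -splitr. Qed.

Lemma small_le (R : realType) (d e : R) (t : circle R) :
  d <= e -> small d t -> small e t.
Proof. by move=> de [x -> xd]; exists x => //; exact: lt_le_trans xd de. Qed.

Lemma small_eq0 (R : realType) (t : circle R) :
  (forall d : R, 0 < d -> small d t) -> t = 0.
Proof.
case: t => y y01; set t := Circle y01 => H; have /andP[hy0 hy1] := y01.
have [y0|y0] := eqVneq y 0; first by rewrite -[t]tor_cval /= y0 raddf0.
(* This minimum is the distance from y to the nearest integer: a representative y + m of smaller
   absolute value would have -1 < m < 0. *)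
have : 0 < Num.min y (1 - y).
  by rewrite lt_min lt_def y0 hy0 subr_gt0.
move=> /H[x]; rewrite -[t]tor_cval /= => /esym/tor_eq[m ->].
rewrite lt_min !ltr_norml => /andP[/andP[h1 h2] /andP[h3 h4]].
have h5 : (-1 : int)%:~R < m%:~R :> R by rewrite intrN; lra.
have h6 : m%:~R < (0 : int)%:~R :> R by lra.
move: h5 h6; rewrite !ltr_int; lia.
Qed.

Lemma dist_int_small (R : realType) (x d : R) :
  dist_int x < d <-> small d (tor x).
Proof.
split=> [/inf_lt [|_ [m _ <-] h]|[y /tor_eq[m ->] h]].
- by exists `|x - 0%:~R|, 0.
- by exists (x - m%:~R) => //; rewrite -intrN torDz.
apply: le_lt_trans h; apply: ge_inf; last by exists m => //; rewrite addrK.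
by exists 0 => _ [k _ <-].
Qed.

(** * Ultrafilters and limits in the circle *)

Record ultra (I : Type) := Ultra {
  useq :> set I -> Prop;
  uT : useq setT;
  uI : forall A B, useq A -> useq B -> useq (A `&` B);
  uS : forall A B, A `<=` B -> useq A -> useq B;
  u0 : ~ useq set0;
  uC : forall A, useq A \/ useq (~` A) }.

Lemma u_ex (I : Type) (U : ultra I) (A : set I) : U A -> exists i, A i.
Proof.
move=> UA; apply: contrapT => nA; apply: (@u0 _ U); apply: uS UA => i Ai.
by apply: nA; exists i.
Qed.

Lemma u_all (I : Type) (X : eqType) (U : ultra I) (L : seq X) (B : X -> set I) :
  (forall x, x \in L -> U (B x)) -> U [set k | forall x, x \in L -> B x k].
Proof.
elim: L => [|y L IH] H; first by apply: uS (uT U).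
have Uy := H y (mem_head _ _).
have UL : U [set k | forall x, x \in L -> B x k].
  by apply: IH => x xL; apply: H; rewrite inE xL orbT.
apply: uS (uI Uy UL) => k [h1 h2] x.
by rewrite inE => /orP[/eqP ->|/h2].
Qed.

Definition udirac (I : Type) (x : I) : ultra I.
Proof.
exists [set A | A x] => //=; first by move=> A B AB /AB.
by move=> A; exact: lem.
Defined.

(** The law of a two-stage choice, i from [U] and then a point from [P i]. It is kept transparent so
    that membership unfolds by computation. *)
Definition ubind (I J : Type) (U : ultra I) (P : I -> ultra J) : ultra J.
Proof.
exists [set A | U [set i | P i A]] => /=.
- by apply: uS (uT U) => i _; exact: uT.
- by move=> A B UA UB; apply: uS (uI UA UB) => i [hA hB]; exact: uI.
- by move=> A B AB; apply: uS => i; exact: uS.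
- by move=> H; apply: (@u0 _ U); apply: uS H => i /u0.
- move=> A; case: (uC U [set i | P i A]) => H; [by left|right].
  by apply: uS H => i /= nA; case: (uC (P i) A).
Defined.

Definition umap (I J : Type) (h : I -> J) (U : ultra I) : ultra J :=
  ubind U (fun i => udirac (h i)).

Lemma ultra_oo : exists U : ultra nat, forall N, U [set n | (N < n)%N].
Proof.
have [G [UG sG]] := ultraFilterLemma eventually_filter.
have H : forall A, G A \/ G (~` A) by move=> A; exact: in_ultra_setVsetC.
exists (Ultra filterT (@filterI _ G _) (@filterS _ G _)
  (@filter_not_empty _ G _) H) => N.
by apply: sG; exists N.+1.
Qed.

(** Compactness of the circle: the supremum of [E] is the limit in [0, 1] of the representatives. If
    it equals 1, the limit in the circle is 0. *)
Lemma ulim_exists (R : realType) (I : Type) (U : ultra I) (f : I -> circle R) :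
  exists t, forall d : R, 0 < d -> U [set i | small d (f i - t)].
Proof.
pose E := [set x : R | U [set i | x <= cval (f i)]].
have E0 : E 0 by apply: uS (uT U) => i _ /=; case: (f i) => ? /= /andP[].
have ubE : ubound E 1.
  move=> x /u_ex[i /=]; case: (f i) => y /= /andP[_ y1] xy.
  by rewrite ltW // (le_lt_trans xy).
have supE : has_sup E by split; [exists 0|exists 1].
exists (tor (sup E)) => d d0.
have [x Ex xd] := sup_adherent d0 supE.
have nE : ~ E (sup E + d).
  by move=> /(ub_le_sup supE.2); rewrite gerDl leNgt d0.
case: (uC U [set i | sup E + d <= cval (f i)]) => // H.
apply: uS (uI Ex H) => i [/= h1 /negP]; rewrite -ltNge => h2.
exists (cval (f i) - sup E); first by rewrite raddfB /= tor_cval.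
by rewrite ltr_norml; apply/andP; split; lra.
Qed.

HB.lock Definition ulim (R : realType) (I : Type) (U : ultra I) (f : I -> circle R) :=
  projT1 (cid (ulim_exists U f)).

Lemma ulimP (R : realType) (I : Type) (U : ultra I) (f : I -> circle R) (d : R) :
  0 < d -> U [set i | small d (f i - ulim U f)].
Proof. by rewrite ulim.unlock; case: cid => t /= h /h. Qed.

Lemma ulim_eq (R : realType) (I : Type) (U : ultra I) (f : I -> circle R) t :
  (forall d : R, 0 < d -> U [set i | small d (f i - t)]) -> ulim U f = t.
Proof.
move=> H; apply/eqP; rewrite -subr_eq0; apply/eqP/small_eq0 => d d0.
have d20 : 0 < d / 2 by rewrite divr_gt0.
have [i [h1 h2]] := u_ex (uI (H _ d20) (ulimP U f d20)).
have -> : ulim U f - t = (f i - t) + - (f i - ulim U f).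
  by rewrite opprB [RHS]addrC addrA subrK.
by apply: small_half => //; exact: smallN.
Qed.

Lemma ulim_ae (R : realType) (I : Type) (U : ultra I) (f g : I -> circle R) :
  U [set i | f i = g i] -> ulim U f = ulim U g.
Proof.
move=> H; apply: ulim_eq => d d0.
by apply: uS (uI H (ulimP U g d0)) => i [/= -> ].
Qed.

Lemma eq_ulim (R : realType) (I : Type) (U : ultra I) (f g : I -> circle R) :
  f =1 g -> ulim U f = ulim U g.
Proof. by move=> /funext ->. Qed.

Lemma ulim_cst (R : realType) (I : Type) (U : ultra I) (t : circle R) :
  ulim U (fun=> t) = t.
Proof.
apply: ulim_eq => d d0; apply: uS (uT U) => i _ /=.
by rewrite subrr; exact: small0.
Qed.

Lemma ulimD (R : realType) (I : Type) (U : ultra I) (f g : I -> circle R) :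
  ulim U (fun i => f i + g i) = ulim U f + ulim U g.
Proof.
apply: ulim_eq => d d0; have d20 : 0 < d / 2 by rewrite divr_gt0.
apply: uS (uI (ulimP U f d20) (ulimP U g d20)) => i [h1 h2] /=.
by rewrite opprD addrACA; exact: small_half.
Qed.

Lemma ulimN (R : realType) (I : Type) (U : ultra I) (f : I -> circle R) :
  ulim U (fun i => - f i) = - ulim U f.
Proof.
apply: ulim_eq => d d0; apply: uS (ulimP U f d0) => i h /=.
by rewrite -opprD; exact: smallN.
Qed.

Lemma ulimMn (R : realType) (I : Type) (U : ultra I) (f : I -> circle R) k :
  ulim U (fun i => f i *+ k) = ulim U f *+ k.
Proof.
elim: k => [|k IH]; first by rewrite (eq_ulim _ (g := fun=> 0)) ?ulim_cst.
by under eq_ulim do rewrite mulrS; rewrite ulimD IH mulrS.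
Qed.

Lemma ulimMz (R : realType) (I : Type) (U : ultra I) (f : I -> circle R)
    (k : int) : ulim U (fun i => f i *~ k) = ulim U f *~ k.
Proof.
case: k => k; first by rewrite -pmulrn -ulimMn; apply: eq_ulim.
rewrite NegzE mulrNz -pmulrn -ulimMn -ulimN.
by apply: eq_ulim => i; rewrite mulrNz -pmulrn.
Qed.

Lemma ulim_sum (R : realType) (I : Type) (U : ultra I) (n : nat)
    (f : nat -> I -> circle R) :
  ulim U (fun i => \sum_(j < n) f j i) = \sum_(j < n) ulim U (f j).
Proof.
elim: n => [|n IH].
  by rewrite big_ord0 (eq_ulim _ (g := fun=> 0)) ?ulim_cst // => i; rewrite big_ord0.
by under eq_ulim do rewrite big_ord_recr; rewrite ulimD IH big_ord_recr.
Qed.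

Lemma ulim_bind (R : realType) (I J : Type) (U : ultra I) (P : I -> ultra J)
    (f : J -> circle R) :
  ulim (ubind U P) f = ulim U (fun i => ulim (P i) f).
Proof.
apply: ulim_eq => d d0; have d20 : 0 < d / 2 by rewrite divr_gt0.
apply: uS (ulimP U (fun i => ulim (P i) f) d20) => i /= hi.
apply: uS (ulimP (P i) f d20) => j /= hj.
by have := small_half hj hi; rewrite addrA subrK.
Qed.

Lemma ulim_dirac (R : realType) (I : Type) (x : I) (f : I -> circle R) :
  ulim (udirac x) f = f x.
Proof. by apply: ulim_eq => d d0 /=; rewrite subrr; exact: small0. Qed.

Lemma ulim_map (R : realType) (I J : Type) (h : I -> J) (U : ultra I)
    (f : J -> circle R) : ulim (umap h U) f = ulim U (f \o h).
Proof. by rewrite ulim_bind; apply: eq_ulim => i; rewrite ulim_dirac. Qed.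

(** * Difference operators of ultrafilters *)

(** Convolution, with x drawn from [p] before y is drawn from [q]. It is not commutative, which the
    necessity proof exploits. *)
Definition uadd (A : zmodType) (p q : ultra A) : ultra A :=
  ubind p (fun x => umap (fun y => x + y) q).

Definition uopp (A : zmodType) (p : ultra A) : ultra A := umap -%R p.

Lemma ulim_add (R : realType) (A : zmodType) (p q : ultra A)
    (f : A -> circle R) :
  ulim (uadd p q) f = ulim p (fun x => ulim q (fun y => f (x + y))).
Proof. by rewrite ulim_bind; apply: eq_ulim => x; rewrite ulim_map. Qed.

(* The law of the difference operator applied to 2^l independent choices from
   [p], later choices being made in dependence on the earlier ones. *)
Fixpoint udiff (A : zmodType) (l : nat) (p : ultra A) : ultra A :=
  if l is l'.+1 then uadd (uopp (udiff l' p)) (udiff l' p) else p.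

Lemma udiffD (A : zmodType) (l m : nat) (p : ultra A) :
  udiff l (udiff m p) = udiff (l + m) p.
Proof. by elim: l => //= l ->. Qed.

Lemma udiffSE (A : zmodType) (l : nat) (p : ultra A) (B : set A) :
  udiff l.+1 p B = udiff l p [set x | udiff l p [set y | B (- x + y)]].
Proof. by []. Qed.

Lemma ulim_udiffS (R : realType) (A : zmodType) (l : nat) (p : ultra A)
    (f : A -> circle R) :
  ulim (udiff l.+1 p) f =
  ulim (udiff l p) (fun x => ulim (udiff l p) (fun y => f (y - x))).
Proof.
rewrite /= ulim_add ulim_map; apply: eq_ulim => x /=.
by apply: eq_ulim => y; rewrite addrC.
Qed.

(** * Extracting sequences from an ultrafilter: the Ramsey argument *)

Fixpoint gdiff (A : zmodType) (l : nat) (m : seq A) : A :=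
  if l is l'.+1 then gdiff l' (drop (2 ^ l') m) - gdiff l' (take (2 ^ l') m)
  else head 0 m.

Lemma pdiffE (l : nat) (m : seq int) : pdiff l m = gdiff l m.
Proof. by elim: l m => //= l IH m; rewrite !IH. Qed.

(** The m-fold tensor power of [U], written as nested quantifiers with the earliest choice
    outermost. *)
Fixpoint allU (I : Type) (U : ultra I) (m : nat) (P : seq I -> Prop) : Prop :=
  if m is m'.+1 then U [set k | allU U m' (fun s => P (k :: s))] else P [::].

Lemma allU_sub (I : Type) (U : ultra I) (m : nat) (P Q : seq I -> Prop) :
  (forall s, size s = m -> P s -> Q s) -> allU U m P -> allU U m Q.
Proof.
elim: m P Q => [|m IH] P Q PQ /=; first exact: PQ.
by apply: uS => k; apply: IH => s sm; apply: PQ; rewrite /= sm.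
Qed.

Lemma allU_cat (I : Type) (U : ultra I) (a b : nat) (P : seq I -> Prop) :
  allU U a (fun s => allU U b (fun t => P (s ++ t))) -> allU U (a + b) P.
Proof.
elim: a P => [|a IH] P //=.
by apply: uS => k; exact: (IH (fun s => P (k :: s))).
Qed.

(** In [udiff l.+1] the subtracted half is drawn first, so the first 2^l choices form the block that
    [gdiff] subtracts. *)
Lemma udiff_allU (I : Type) (A : zmodType) (U : ultra I) (n : I -> A) (l : nat)
    (B : set A) :
  udiff l (umap n U) B -> allU U (2 ^ l) (fun s => B (gdiff l (map n s))).
Proof.
elim: l B => [|l IH] B //.
move=> /= /(IH [set x | udiff l (umap n U) [set y | B (- x + y)]]) H.
rewrite expnS mul2n -addnn; apply: allU_cat; apply: allU_sub H => s ss.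
move=> /(IH [set y | B (- gdiff l (map n s) + y)]); apply: allU_sub => t st.
by rewrite /= map_cat drop_size_cat ?take_size_cat ?size_map // addrC.
Qed.

(* The subsequences of a sequence that is listed from its last term. *)
Fixpoint rsubs (T : Type) (c : seq T) : seq (seq T) :=
  if c is x :: c' then rsubs c' ++ [seq rcons s x | s <- rsubs c']
  else [:: [::]].

Fixpoint rprefix (T : Type) (e : nat -> T) (k : nat) : seq T :=
  if k is k'.+1 then e k' :: rprefix e k' else [::].

Lemma mem_rprefix (T : eqType) (e : nat -> T) (i k : nat) :
  (i < k)%N -> e i \in rprefix e k.
Proof.
elim: k => // k IH; rewrite ltnS leq_eqVlt inE => /orP[/eqP ->|/IH ->].
  by rewrite eqxx.
by rewrite orbT.
Qed.

Lemma mem_rsubs (T : eqType) (e : nat -> T) (k : nat) (js : seq nat) :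
  sorted ltn js -> all (ltn^~ k) js -> map e js \in rsubs (rprefix e k).
Proof.
elim: k js => [|k IH] js; first by case: js.
case/lastP: js => [|js j] sjs jk /=; rewrite mem_cat.
  by have /= -> := IH [::] isT isT.
move: jk; rewrite all_rcons /= ltnS => /andP[jk1 jsk].
have jsj : all (ltn^~ j) js.
  apply/allP => i ij; have := sjs; rewrite -cats1.
  rewrite sorted_pairwise; last exact: ltn_trans.
  by rewrite pairwise_cat => /and3P[/allP /(_ i ij) /andP[]].
have sj : sorted ltn js.
  by move: sjs; apply: subseq_sorted; [exact: ltn_trans|exact: subseq_rcons].
move: jk1; rewrite leq_eqVlt => /orP[/eqP ej|ltjk].
  subst j; rewrite map_rcons; apply/orP; right; apply/mapP; exists (map e js) => //.
  exact: IH.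
rewrite IH //= all_rcons ltjk /=.
by apply: sub_all jsj => i ij; exact: ltn_trans ltjk.
Qed.

(** Greedy construction. The invariant says that each subsequence of the chosen terms, if of length
    at most m, satisfies [P] once completed by generic further choices. A step meets only finitely
    many subsequences, so one new term serves them all. *)
Lemma allU_sequence (I : choiceType) (U : ultra I) (lt : I -> I -> Prop)
    (m : nat) (P : seq I -> Prop) :
  (forall i, U [set k | lt i k]) -> allU U m P ->
  exists e : nat -> I, (forall i j, (i < j)%N -> lt (e i) (e j)) /\
    forall js, sorted ltn js -> size js = m -> P (map e js).
Proof.
move=> Ult UP.
pose Q s := allU U (m - size s) (fun t => P (s ++ t)).
pose Inv c := forall s, s \in rsubs c -> (size s <= m)%N -> Q s.
have step c : Inv c -> exists x, Inv (x :: c) /\ forall y, y \in c -> lt y x.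
  move=> ic.
  have U1 : U [set x | forall y, y \in c -> lt y x].
    exact: (u_all (B := fun y => [set x | lt y x])).
  have U2 : U [set x | forall s, s \in rsubs c -> (size s < m)%N -> Q (rcons s x)].
    apply: (u_all (B := fun s => [set x | (size s < m)%N -> Q (rcons s x)])) => s sc.
    have [ltsm|_] := ltnP (size s) m; last by apply: uS (uT U).
    have := ic s sc (ltnW ltsm); rewrite /Q -(subnSK ltsm) /=.
    apply: uS => x H _; rewrite size_rcons; apply: allU_sub H => t _.
    by rewrite cat_rcons.
  have [x [h1 h2]] := u_ex (uI U1 U2); exists x; split => // s.
  rewrite /= mem_cat => /orP[/ic //|/mapP[s' s'c ->]].
  by rewrite size_rcons; exact: h2.
(* A dummy value where the invariant fails makes the successor a total function [nxt]. *)
have [x0 _] : exists x : I, True by have [x _] := u_ex (uT U); exists x.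
have H c : exists x, Inv c -> Inv (x :: c) /\ forall y, y \in c -> lt y x.
  have [ic|nic] := pselect (Inv c); last by exists x0.
  by have [x hx] := step c ic; exists x.
have [nxt nxtP] := choice H.
pose pre := fix pre k := if k is k'.+1 then nxt (pre k') :: pre k' else [::].
pose e k := nxt (pre k).
have preE k : rprefix e k = pre k by elim: k => //= k ->.
have inv k : Inv (pre k).
  elim: k => [|k IH] /=; last by have [] := nxtP _ IH.
  by move=> s; rewrite inE => /eqP -> _; rewrite /Q subn0.
exists e; split=> [i j ij|js sjs sm].
  by have [_ +] := nxtP _ (inv j); apply; rewrite -preE; exact: mem_rprefix.
pose k := (\max_(j <- js) j).+1.
have jsk : all (ltn^~ k) js.
  by apply/allP => j jjs; rewrite /= /k ltnS (big_rem j) //= leq_maxl.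
have := inv k (map e js); rewrite -preE size_map sm.
move=> /(_ (mem_rsubs _ sjs jsk) (leqnn _)).
by rewrite /Q size_map sm subnn /= cats0.
Qed.

Lemma udiff_sequence (I : choiceType) (A : zmodType) (U : ultra I)
    (lt : I -> I -> Prop) (n : I -> A) (l : nat) (B : set A) :
  (forall i, U [set k | lt i k]) -> udiff l (umap n U) B ->
  exists e : nat -> I, (forall i j, (i < j)%N -> lt (e i) (e j)) /\
    forall js, sorted ltn js -> size js = (2 ^ l)%N ->
      B (gdiff l (map (n \o e) js)).
Proof.
move=> Ult /udiff_allU H; have [e [he1 he2]] := allU_sequence Ult H.
by exists e; split=> // js h1 h2; rewrite map_comp; exact: he2.
Qed.

(** * Additive maps and odd powers along difference operators *)

Definition is_add (A B : zmodType) (chi : A -> B) : Prop :=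
  {morph chi : x y / x + y}.

Lemma is_add0 (A B : zmodType) (chi : A -> B) : is_add chi -> chi 0 = 0.
Proof.
by move=> h; apply: (addIr (chi 0)); rewrite -h !add0r.
Qed.

Lemma is_addN (A B : zmodType) (chi : A -> B) :
  is_add chi -> {morph chi : x / - x}.
Proof.
move=> h x; apply: (addIr (chi x)).
by rewrite -h !addNr is_add0.
Qed.

Lemma is_addMn (A B : zmodType) (chi : A -> B) (n : nat) :
  is_add chi -> {morph chi : x / x *+ n}.
Proof.
by move=> h x; elim: n => [|n IH]; rewrite ?mulr0n ?is_add0 // !mulrS h IH.
Qed.

Lemma is_add_sum (A B : zmodType) (chi : A -> B) (n : nat) (F : 'I_n -> A) :
  is_add chi -> chi (\sum_(i < n) F i) = \sum_(i < n) chi (F i).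
Proof. by move=> h; apply: big_morph => //; exact: is_add0. Qed.

Lemma is_add_int (B : zmodType) (chi : int -> B) (n : int) :
  is_add chi -> chi n = chi 1 *~ n.
Proof.
move=> h; have e k : chi (Posz k) = chi 1 *+ k by rewrite -is_addMn // natz.
case: n => n; first exact: e.
by rewrite NegzE is_addN // (e n.+1) mulrNz.
Qed.

Lemma big_ord_ends (B : zmodType) (n : nat) (F : nat -> B) :
  (0 < n)%N -> (forall i, (0 < i < n)%N -> F i = 0) ->
  \sum_(i < n.+1) F i = F 0%N + F n.
Proof.
case: n => // n _ h; rewrite big_ord_recl big_ord_recr /= big1 ?add0r // => i _.
by apply: h; rewrite /bump /= add1n ltnS ltn_ord.
Qed.

(** Here i is the exponent of x, the earlier choice, so the inner limit over y has x^i as a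
    coefficient. *)
Lemma ulim_udiffX (R : realType) (A : comPzRingType) (p : ultra A) (l e : nat)
    (chi : A -> circle R) : is_add chi ->
  ulim (udiff l.+1 p) (fun x => chi (x ^+ e)) =
  \sum_(i < e.+1) ulim (udiff l p) (fun x => ulim (udiff l p)
     (fun y => chi (y ^+ (e - i) * x ^+ i))) *~ (-1) ^+ i *+ 'C(e, i).
Proof.
move=> hchi; rewrite ulim_udiffS.
pose F i x := ulim (udiff l p) (fun y => chi (y ^+ (e - i) * x ^+ i)) *~ (-1) ^+ i
  *+ 'C(e, i).
under eq_ulim => x.
  under eq_ulim => y.
    rewrite exprBn is_add_sum //.
    under eq_bigr => i _.
      rewrite is_addMn // -mulrA.
      have -> : chi ((-1) ^+ i * (y ^+ (e - i) * x ^+ i)) =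
          chi (y ^+ (e - i) * x ^+ i) *~ (-1) ^+ i.
        rewrite -signr_odd -[in RHS]signr_odd; case: (odd i).
          by rewrite !expr1 mulN1r mulrN1z is_addN.
        by rewrite !expr0 mul1r mulr1z.
    over.
  over.
  rewrite (ulim_sum _ _ (fun i y =>
    chi (y ^+ (e - i) * x ^+ i) *~ (-1) ^+ i *+ 'C(e, i))).
  under eq_bigr => i _ do rewrite ulimMn ulimMz.
over.
rewrite /= (ulim_sum _ _ F); apply: eq_bigr => i _.
by rewrite /F ulimMn ulimMz.
Qed.

(* Expand (y - x)^e: the pure terms cancel since e is odd, and in a mixed term
   x^i y^(e - i) one of the two exponents is odd and at most e - 2. If it is the
   exponent of y, the inner limit vanishes; if it is that of x, the inner limit is
   additive in the coefficient, so that the outer limit vanishes. *)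
Lemma udiff_odd (R : realType) (A : comPzRingType) (p : ultra A) (t : nat) :
  (forall chi : A -> circle R, is_add chi -> forall e, odd e -> (e < t)%N ->
     ulim p (fun x => chi (x ^+ e)) = 0) ->
  forall (m : nat) (chi : A -> circle R) (e : nat), is_add chi -> odd e ->
    (e < t + 2 * m)%N -> ulim (udiff m p) (fun x => chi (x ^+ e)) = 0.
Proof.
move=> Hp; elim=> [|m IH] chi e hchi oe; first by rewrite addn0; exact: Hp.
rewrite mulnS addnCA => lte; rewrite ulim_udiffX //.
have e0 : (0 < e)%N by case: (e) oe.
rewrite (big_ord_ends (F := fun i => ulim (udiff m p) (fun x => ulim (udiff m p)
     (fun y => chi (y ^+ (e - i) * x ^+ i))) *~ (-1) ^+ i *+ 'C(e, i))) //.
  rewrite bin0 binn !mulr1n subn0 subnn expr0 mulr1z -signr_odd oe expr1 mulrN1z.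
  under eq_ulim do under eq_ulim do rewrite mulr1.
  rewrite ulim_cst; under [X in _ - X]eq_ulim do under eq_ulim do rewrite mul1r.
  under [X in _ - X]eq_ulim do rewrite ulim_cst.
  by rewrite subrr.
move=> i /andP[i0 ie].
suff -> : ulim (udiff m p) (fun x => ulim (udiff m p)
     (fun y => chi (y ^+ (e - i) * x ^+ i))) = 0 by rewrite mul0rz mul0rn.
have [oi|ei] := boolP (odd i).
  under eq_ulim do under eq_ulim do rewrite mulrC.
  apply: (IH (fun a => ulim (udiff m p) (fun y => chi (a * y ^+ (e - i))))) => //.
    by move=> a b; rewrite -ulimD; apply: eq_ulim => y; rewrite mulrDl hchi.
  have : (1 < e - i)%N.
    have : ~~ odd (e - i) by rewrite oddB ?oe ?oi // ltnW.
    by case: (e - i)%N (subn_gt0 i e) => [|[|]] //; rewrite ie.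
  lia.
rewrite (eq_ulim _ (g := fun=> 0)) ?ulim_cst // => x.
apply: (IH (fun a => chi (a * x ^+ i))).
- by move=> a b; rewrite mulrDl hchi.
- by rewrite oddB ?oe ?(negbTE ei) // ltnW.
by case: (i) i0 ei lte ie => [|[|k]] // *; lia.
Qed.

(** * Sufficiency *)

Definition torsion (R : realType) (t : circle R) : Prop :=
  exists2 N : int, N != 0 & t *~ N = 0.

(** Condition (i) read on coefficients: rational means torsion in R/Z, and the odd coefficients of
    degree below 2l are free. *)
Definition coef_cond (R : realType) (l : nat) (v : {poly R}) : Prop :=
  tor v`_0 = 0 /\ forall i, (0 < i)%N -> ~~ odd i || (2 * l <= i)%N ->
    torsion (tor v`_i).

Lemma torsion_ratr (R : realType) (q : rat) : torsion (tor (ratr q : R)).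
Proof.
exists (denq q); first exact: denq_neq0.
rewrite tor_mulz; apply/tor_eq0; exists (numq q).
by rewrite /ratr divfK // intr_eq0 denq_neq0.
Qed.

Lemma torsion_rat (R : realType) (x : R) : torsion (tor x) -> exists q, x = ratr q.
Proof.
move=> [N N0]; rewrite tor_mulz => /tor_eq0[m e].
exists (m%:~R / N%:~R); rewrite fmorph_div /= !ratr_int -e mulfK //.
by rewrite intr_eq0.
Qed.

Lemma odd_poly_form_even (R : realType) (p : {poly R}) (i : nat) :
  odd_poly_form p -> ~~ odd i -> p`_i = 0.
Proof.
move=> [k [a ->]] ei; rewrite coef_sum big_nat big1 // => j /andP[j0 _].
rewrite coefZ coefXn; case: eqP => [e|_]; last by rewrite mulr0.
by move: ei; rewrite e; lia.
Qed.

Lemma coef_odd_poly (R : realType) (a : nat -> R) (k i : nat) :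
  (\sum_(1 <= j < k.+1) a j *: 'X^(2 * j - 1) : {poly R})`_i =
  if odd i && (i < 2 * k)%N then a i./2.+1 else 0.
Proof.
rewrite coef_sum; case: ifP => [/andP[oi ik]|h].
  rewrite (bigD1_seq i./2.+1) ?iota_uniq //=; last by rewrite mem_index_iota; lia.
  rewrite coefZ coefXn (_ : 2 * i./2.+1 - 1 = i)%N; last by lia.
  rewrite eqxx mulr1 big1 ?addr0 // => j ji; rewrite coefZ coefXn.
  case: eqP => [e|_]; last by rewrite mulr0.
  by move/eqP: ji; lia.
rewrite big_nat big1 // => j /andP[j0 jk]; rewrite coefZ coefXn.
case: eqP => [e|_]; last by rewrite mulr0.
by move: h; lia.
Qed.

Lemma coef_condP (R : realType) (l : nat) (v : {poly R}) :
  (exists w : {poly rat}, [/\ w.[0] \is a Num.int,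
     odd_poly_form (v - map_poly ratr w)
   & (size (v - map_poly ratr w)%R <= 2 * l)%N]) <-> coef_cond l v.
Proof.
split=> [[w [w0 ow sw]]|[v0 vi]].
  have E i : ~~ odd i || (2 * l <= i)%N -> v`_i = ratr w`_i.
    move=> h; apply/eqP; rewrite -subr_eq0 -[ratr _]coef_map -coefB; apply/eqP.
    case/orP: h => [|h]; first exact: odd_poly_form_even.
    by apply: nth_default; exact: leq_trans h.
  split=> [|i _ /E ->]; last exact: torsion_ratr.
  rewrite E //; apply/tor_eq0; move: w0; rewrite horner_coef0.
  by move=> /intrP[m ->]; exists m; rewrite ratr_int.
(* The odd coefficients of degree below 2l stay in v - w, so w gets 0 there; all others go into
   w. *)
have H i : exists q : rat, if ~~ odd i || (2 * l <= i)%N then v`_i = ratr q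
    else q = 0.
  case: (boolP (~~ odd i || _)) => h; last by exists 0.
  case: i h => [|i] h; last by apply/torsion_rat/vi.
  by have /tor_eq0[m ->] := v0; exists m%:~R; rewrite ratr_int.
have [q qP] := choice H.
pose w : {poly rat} := \poly_(i < size v) q i.
have E i : (v - map_poly ratr w)`_i = if odd i && (i < 2 * l)%N then v`_i else 0.
  rewrite coefB coef_map coef_poly /=; have := qP i.
  case: (boolP (odd i && _)) => h.
    have -> : ~~ odd i || (2 * l <= i)%N = false by lia.
    by move=> ->; rewrite if_same rmorph0 subr0.
  have -> : ~~ odd i || (2 * l <= i)%N = true by lia.
  case: ifP => isz; first by move=> ->; rewrite subrr.
  by move=> _; rewrite rmorph0 subr0 nth_default // leqNgt isz.
exists w; split.
- rewrite horner_coef0 coef_poly; case: ifP => // _.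
  have := qP 0%N => /= e; have /tor_eq0[m] := v0.
  rewrite e -(ratr_int R) => /(fmorph_inj (@ratr R)) ->.
  exact: intr_int.
- exists l, (fun j => v`_(2 * j - 1)); apply/polyP => i.
  rewrite E coef_odd_poly; case: ifP => // h.
  by congr (_`_ _); lia.
- apply/leq_sizeP => i hi; rewrite E.
  by case: ifP => //; lia.
Qed.

Lemma tor_horner (R : realType) (v : {poly R}) (n : int) :
  tor v.[n%:~R] = \sum_(i < size v) tor v`_i *~ n ^+ i.
Proof.
rewrite horner_coef raddf_sum; apply: eq_bigr => i _.
by rewrite tor_mulz rmorphXn.
Qed.

(** An ultrafilter selects one of finitely many residue classes. The induction lowers a bound k on
    the residue until k itself is selected. *)
Lemma ultra_mod (I : Type) (U : ultra I) (h : I -> int) (N : int) :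
  N != 0 -> exists c, U [set i | (N %| h i - c)%Z].
Proof.
move=> N0.
have H (k : nat) : U [set i | (h i %% N)%Z < k%:Z] ->
    exists c, U [set i | (N %| h i - c)%Z].
  elim: k => [|k IH] Uk.
    have [i /=] := u_ex Uk; have := modz_ge0 (h i) N0; lia.
  case: (uC U [set i | (h i %% N)%Z < k%:Z]) => [/IH //|Uk'].
  exists k%:Z; apply: uS (uI Uk Uk') => i /= [h1 h2].
  have -> : k%:Z = (h i %% N)%Z by move: h2 => /negP; lia.
  by rewrite -eqz_mod_dvd modz_mod.
by apply: (H `|N|%N); apply: uS (uT U) => i _ /=; rewrite abszE ltz_mod.
Qed.

Lemma udiff_dvd (I : Type) (U : ultra I) (p : ultra (I -> int)) (N : int)
    (m : nat) : N != 0 ->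
  udiff m.+1 p [set x : I -> int | U [set r | (N %| x r)%Z]].
Proof.
move=> N0; elim: m => [|m IH]; rewrite udiffSE.
  (* Residues are selected twice: c x is that of x along [U], and d is that of c x along [p]. Two
     generic elements x and y then agree modulo N. *)
  have [c cP] := choice (fun x : I -> int => ultra_mod U x N0).
  have [d dP] := ultra_mod p c N0.
  apply: uS (dP) => x /= dx; apply: uS dP => y /= dy.
  apply: uS (uI (cP x) (cP y)) => r /= [hx hy].
  rewrite -[(- x + y) r]/(- x r + y r).
  have -> : - x r + y r =
      (y r - c y) - (x r - c x) + ((c y - d) - (c x - d)) by ring.
  by apply: rpredD; apply: rpredB.
apply: (uS _ IH) => x hx; apply: (uS _ IH) => y hy.
apply: uS (uI hx hy) => r /= [rx ry].
by rewrite -[(- x + y) r]/(- x r + y r) rpredD ?rpredN.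
Qed.

Lemma fctX (I : Type) (x : I -> int) (e : nat) (r : I) :
  (x ^+ e) r = x r ^+ e.
Proof. by elim: e => // e IH; rewrite !exprS -IH. Qed.

Lemma gdiff_fct (I J : Type) (n : J -> I -> int) (l : nat) (js : seq J) (r : I) :
  gdiff l (map n js) r = pdiff l (map (n^~ r) js).
Proof.
elim: l js => [|l IH] js /=; first by case: js.
by rewrite -!map_drop -!map_take -!IH.
Qed.

Lemma Delta_fin_star_failure (R : realType) (l r : nat) (v : {poly R}) (eps : R) :
  (0 < r)%N -> ~ is_Delta_fin_star l r (ret_set v eps) ->
  exists m : nat -> int, forall js : seq nat, sorted ltn js ->
    size js = (2 ^ l)%N -> all (ltn^~ r) js ->
    ~ small eps (tor v.[(pdiff l (map m js))%:~R]).
Proof.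
case: r => // r _ H; apply: contrapT => nm; apply: H.
split=> [n []//|F [Fpos [n nF]]]; apply: contrapT => nRF; apply: nm.
(* [inord] extends the finite sequence to [nat]; its values are meaningful only below r, hence the
   bound on [js]. *)
exists (fun k => n (inord k)) => js sjs sz jsr /dist_int_small sm.
have D : Dset l n (pdiff l (map (fun k => n (inord k)) js)).
  exists (map inord js); last by rewrite -map_comp.
  split; first by rewrite size_map.
  apply: (homo_sorted_in _ jsr sjs) => i j ir jr /= ij.
  by rewrite ltEord /= !inordK.
apply: nRF; exists (pdiff l (map (fun k => n (inord k)) js)); split; last exact: nF.
by split=> //; exact/Fpos/nF.
Qed.

(** If no r works, the counterexamples for all r are combined into one sequence in the ring of
    functions from [nat] to [int]. The limit of v along its differences is 0, and a generic
    coordinate r contradicts the choice of its counterexample. *)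
Lemma coef_cond_Delta_fin_star (R : realType) (l : nat) (v : {poly R}) (eps : R) :
  (0 < l)%N -> coef_cond l v -> 0 < eps ->
  exists r, (2 ^ l <= r)%N /\ is_Delta_fin_star l r (ret_set v eps).
Proof.
move=> l0 [v0 vi] eps0; apply: contrapT => H.
have bad r : exists m : nat -> int, (2 ^ l <= r)%N -> forall js : seq nat,
    sorted ltn js -> size js = (2 ^ l)%N -> all (ltn^~ r) js ->
    ~ small eps (tor v.[(pdiff l (map m js))%:~R]).
  have [lr|] := leqP (2 ^ l) r; last by exists (fun=> 0).
  have r0 : (0 < r)%N by rewrite (leq_trans _ lr) // expn_gt0.
  have [m mP] : exists m : nat -> int, forall js : seq nat, sorted ltn js ->
      size js = (2 ^ l)%N -> all (ltn^~ r) js ->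
      ~ small eps (tor v.[(pdiff l (map m js))%:~R]).
    by apply: Delta_fin_star_failure => // h; apply: H; exists r.
  by exists m.
have [mm mmP] := choice bad; have [U Utail] := ultra_oo.
pose N k := fun r => mm r k.
pose p := umap N U.
pose V (x : nat -> int) := ulim U (fun r => tor v.[(x r)%:~R]).
pose chi i (a : nat -> int) := ulim U (fun r => tor v`_i *~ a r).
have chiD i : is_add (chi i).
  by move=> a b; rewrite -ulimD; apply: eq_ulim => r; rewrite -mulrzDr.
have VE x : V x = \sum_(i < size v) chi i (x ^+ i).
  rewrite -(ulim_sum U (size v) (fun i r => tor v`_i *~ (x ^+ i) r)).
  apply: eq_ulim => r; rewrite tor_horner.
  by apply: eq_bigr => i _; rewrite fctX.
have V0 : ulim (udiff l p) V = 0.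
  under eq_ulim do rewrite VE.
  rewrite (ulim_sum _ _ (fun i x => chi i (x ^+ i))) big1 // => i _.
  have [/andP[oi il]|] := boolP (odd i && (i < 2 * l)%N).
    (* Taking t = 0 gives all odd exponents below 2l for an arbitrary p. *)
    by apply: (@udiff_odd _ _ p 0) => //.
  rewrite negb_and -leqNgt => h.
  have [i0|i0] := posnP i.
    rewrite (eq_ulim _ (g := fun=> 0)) ?ulim_cst // => x.
    rewrite /chi (eq_ulim _ (g := fun=> 0)) ?ulim_cst // => r.
    by rewrite i0 v0 mul0rz.
  have [M M0 tM] := vi _ i0 h.
  rewrite (@ulim_ae _ _ _ _ (fun=> 0)) ?ulim_cst //.
  move: l0; case: (l) => // l' _.
  apply: uS (udiff_dvd U p l' M0) => x /= dx.
  rewrite /chi (@ulim_ae _ _ _ _ (fun=> 0)) ?ulim_cst //.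
  apply: uS dx => r /= /dvdzP[q xr]; rewrite fctX xr.
  case: (nat_of_ord i) i0 tM => // j _ tM.
  by rewrite exprS mulrAC mulrC mulrzA tM mul0rz.
have eps20 : 0 < eps / 2 by rewrite divr_gt0.
have := ulimP (udiff l p) V eps20; rewrite V0 => /(udiff_sequence Utail).
move=> [e [e_lt eP]]; pose js := iota 0 (2 ^ l).
have := eP js (iota_ltn_sorted _ _) (size_iota _ _).
set x := gdiff _ _; rewrite /= subr0 => Vx.
(* Choose r beyond 2^l and beyond every index used, with v at x r within eps / 2 of the limit
   [V x]. *)
have := uI (ulimP U (fun r => tor v.[(x r)%:~R]) eps20)
  (uI (Utail (2 ^ l)%N) (Utail (e (2 ^ l)%N))).
move=> /u_ex[r [/= h1 [h2 h3]]].
apply: (mmP r (ltnW h2) (map e js)).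
- exact: (homo_sorted (e := ltn) (e' := ltn) e_lt _ (iota_ltn_sorted _ _)).
- by rewrite size_map size_iota.
- rewrite all_map; apply/allP => j; rewrite mem_iota /= add0n => jl.
  exact: ltn_trans (e_lt _ _ jl) h3.
have := small_half h1 Vx; rewrite subrK /x gdiff_fct.
by rewrite -map_comp.
Qed.

(** For l > 1 the differences of an increasing sequence may be negative, whereas a Delta set
    consists of positive integers. An ultrafilter at infinity provides a subsequence all of whose
    differences are positive. *)
Lemma Delta_fin_star_Delta_star (R : realType) (l : nat) (E : set int) (r : nat) :
  (0 < l)%N -> is_Delta_fin_star l r E -> is_Delta_star l E.
Proof.
move=> l0 [Epos ES]; split=> // n npos nlt; have [U Utail] := ultra_oo.
have Un (N : int) : umap n U [set d | N < d].
  apply: uS (Utail `|N|%N) => k /= Nk.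
  have kn : (k%:Z <= n k).
    elim: k {Nk} => [|k IH]; first exact/ltW/npos.
    by have := nlt k k.+1 (ltnSn _); lia.
  by lia.
have Upos (N : int) : udiff l (umap n U) [set d | N < d].
  elim: (l) N => [|l' IH] N; first exact: Un.
  rewrite udiffSE; apply: uS (uT _) => x _ /=.
  by apply: uS (IH (N + x)) => y /=; lia.
have [e [e_lt eP]] := udiff_sequence Utail (Upos 0).
have [d [Ed [js [szj sj] ejs]]] : E `&` Dset l (fun i : 'I_r => n (e i)) !=set0.
  apply: ES; split; last by exists (fun i : 'I_r => n (e i)).
  move=> _ [js [szj sj] <-]; rewrite /posint /= pdiffE.
  have := eP (map val js); rewrite size_map -map_comp; apply=> //.
  by apply: homo_sorted sj => i j; rewrite ltEord.
exists d; split=> //; exists (map (e \o val) js); last by rewrite -map_comp.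
split; first by rewrite size_map.
by apply: homo_sorted sj => i j; rewrite ltEord => /e_lt.
Qed.

(** * Ultrafilters on the integers *)

(** The half-lines allow increasing positive sequences to be drawn from [p]; the ideals make every
    tau of positive order kill torsion. *)
Definition good (p : ultra int) : Prop :=
  (forall N, p [set n | N < n]) /\
  (forall N, N != 0 -> p [set n | (N %| n)%Z]).

Lemma good_exists : exists p, good p.
Proof.
have [U Utail] := ultra_oo; exists (umap (fun i => (i`!)%:Z) U); split=> N.
  by apply: uS (Utail `|N|%N) => i /= Ni; have := fact_geq i; lia.
move=> N0; apply: uS (Utail `|N|%N) => i /= Ni.
by rewrite dvdzE /= dvdn_fact // absz_gt0 N0 ltnW.
Qed.

Lemma uadd_tail (p q : ultra int) (N : int) : good q -> uadd p q [set n | N < n].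
Proof.
move=> [qt _]; apply: uS (uT p) => x _.
by apply: uS (qt (N - x)) => y /=; lia.
Qed.

Lemma uadd_dvd (p q : ultra int) (N : int) : p [set n | (N %| n)%Z] ->
  q [set n | (N %| n)%Z] -> uadd p q [set n | (N %| n)%Z].
Proof.
move=> hp hq; apply: (uS _ hp) => x hx; apply: (uS _ hq) => y hy.
exact: rpredD.
Qed.

Lemma good_add (p q : ultra int) : good p -> good q -> good (uadd p q).
Proof.
move=> [_ pd] gq; split=> N; first exact: uadd_tail.
by move=> N0; apply: uadd_dvd; [exact: pd|exact: gq.2].
Qed.

Lemma good_udiff (l : nat) (p : ultra int) : good p -> good (udiff l p).
Proof.
move=> gp; elim: l => //= l IH; split=> N; first exact: uadd_tail.
move=> N0; apply: uadd_dvd; last exact: IH.2.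
by apply: uS (IH.2 N N0) => n; rewrite /= rpredN.
Qed.

Lemma good_bind (I : Type) (U : ultra I) (p : I -> ultra int) :
  (forall i, good (p i)) -> good (ubind U p).
Proof.
move=> gp; split=> N; first by apply: uS (uT U) => i _; exact: (gp i).1.
by move=> N0; apply: uS (uT U) => i _; exact: (gp i).2.
Qed.

Definition tau (R : realType) (p : ultra int) (e : nat) (c : circle R) :=
  ulim p (fun n => c *~ n ^+ e).

Lemma tau0 (R : realType) (p : ultra int) (c : circle R) : tau p 0 c = c.
Proof. by rewrite /tau; under eq_ulim do rewrite expr0 mulr1z; exact: ulim_cst. Qed.

Lemma tauD (R : realType) (p : ultra int) (e : nat) : is_add (@tau R p e).
Proof.
by move=> c d; rewrite -ulimD; apply: eq_ulim => n; rewrite mulrzDl.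
Qed.

Lemma tauMn (R : realType) (p : ultra int) (e : nat) (c : circle R) (m : nat) :
  tau p e (c *+ m) = tau p e c *+ m.
Proof. exact: (is_addMn m (tauD p e) c). Qed.

Lemma tau_at0 (R : realType) (p : ultra int) (e : nat) : tau p e (0 : circle R) = 0.
Proof. exact: is_add0 (tauD p e). Qed.

Lemma tau_torsion (R : realType) (p : ultra int) (e : nat) (c : circle R) :
  good p -> (0 < e)%N -> torsion c -> tau p e c = 0.
Proof.
move=> [_ pd] e0 [N N0 cN]; rewrite /tau (@ulim_ae _ _ _ _ (fun=> 0)) ?ulim_cst //.
apply: uS (pd N N0) => n /= /dvdzP[q ->]; case: e e0 => // e _.
by rewrite exprS mulrAC mulrC mulrzA cN mul0rz.
Qed.

(** Binomial expansion of (x + y)^e. The inner limit over y is applied first, so each mixed term is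
    a composite of endomorphisms whose order reflects that of [p] and [q]. *)
Lemma tau_addE (R : realType) (p q : ultra int) (e : nat) (c : circle R) :
  tau (uadd p q) e c =
  \sum_(i < e.+1) tau p (e - i) (tau q i c) *+ 'C(e, i).
Proof.
rewrite /tau ulim_add.
under eq_ulim => x.
  under eq_ulim => y.
    rewrite exprDn (is_add_sum _ (chi := fun n => c *~ n)); last first.
      by move=> ? ?; rewrite mulrzDr.
    under eq_bigr => i _.
      rewrite -mulr_natr natz mulrzA -pmulrn [x ^+ _ * _]mulrC mulrzA.
    over.
  over.
  rewrite (ulim_sum _ _ (fun i y => c *~ y ^+ i *~ x ^+ (e - i) *+ 'C(e, i))).
  under eq_bigr => i _ do rewrite ulimMn ulimMz.
over.
rewrite (ulim_sum _ _ (fun i x =>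
  ulim q (fun n => c *~ n ^+ i) *~ x ^+ (e - i) *+ 'C(e, i))).
by apply: eq_bigr => i _; rewrite ulimMn.
Qed.

Lemma tau_opp (R : realType) (p : ultra int) (e : nat) (c : circle R) :
  tau (uopp p) e c = tau p e c *~ (-1) ^+ e.
Proof.
rewrite /tau ulim_map -ulimMz; apply: eq_ulim => n /=.
by rewrite [in LHS]exprNn mulrC mulrzA.
Qed.

Lemma tau_udiffS (R : realType) (l : nat) (p : ultra int) (e : nat)
    (c : circle R) :
  tau (udiff l.+1 p) e c = \sum_(i < e.+1)
    tau (udiff l p) (e - i) (tau (udiff l p) i c) *~ (-1) ^+ (e - i) *+ 'C(e, i).
Proof. by rewrite [LHS]tau_addE; apply: eq_bigr => i _; rewrite tau_opp. Qed.

(** * Leading orders and quasi-inverses *)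

Definition zeros_below (R : realType) (p : ultra int) (i : nat) : Prop :=
  forall e (c : circle R), (0 < e < i)%N -> tau p e c = 0.

(** Every mixed term contains a tau of [p] of order strictly between 0 and e, so the leading tau is
    additive. *)
Lemma tau_add_lead (R : realType) (p q : ultra int) (e : nat) (c : circle R) :
  (0 < e)%N -> zeros_below R p e ->
  tau (uadd p q) e c = tau p e c + tau q e c.
Proof.
move=> e0 zp; rewrite tau_addE.
rewrite (big_ord_ends (F := fun i => tau p (e - i) (tau q i c) *+ 'C(e, i))) //.
  by rewrite bin0 binn !mulr1n subn0 subnn !tau0.
by move=> i /andP[i0 ie]; rewrite zp ?mul0rn // subn_gt0 ie ltn_subrL i0.
Qed.

Lemma zeros_below_sub (R : realType) (p : ultra int) (i j : nat) :
  (i <= j)%N -> zeros_below R p j -> zeros_below R p i.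
Proof. by move=> ij zp e c /andP[e0 ei]; apply: zp; rewrite e0 (leq_trans ei). Qed.

Lemma zeros_below_add (R : realType) (p q : ultra int) (i : nat) :
  zeros_below R p i -> zeros_below R q i -> zeros_below R (uadd p q) i.
Proof.
move=> zp zq e c /andP[e0 ei].
rewrite tau_add_lead //; last exact: zeros_below_sub (ltnW ei) zp.
by rewrite zp ?zq ?addr0 // e0.
Qed.

Fixpoint upow (p : ultra int) (k : nat) : ultra int :=
  if k is k'.+1 then uadd (upow p k') p else udirac 0.

Lemma tau_upow (R : realType) (p : ultra int) (i k : nat) :
  zeros_below R p i -> zeros_below R (upow p k) i /\
  ((0 < i)%N -> forall c : circle R, tau (upow p k) i c = tau p i c *+ k).
Proof.
move=> zp; elim: k => [|k [IH1 IH2]] /=.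
  have D e (c : circle R) : (0 < e)%N -> tau (udirac 0) e c = 0.
    by move=> e0; rewrite /tau ulim_dirac expr0n; case: e e0.
  by split=> [e c /andP[/D ->]|i0 c] //; rewrite D.
split; first exact: zeros_below_add.
by move=> i0 c; rewrite tau_add_lead // IH2 // mulrSr.
Qed.

Lemma upow_dvd (p : ultra int) (k : nat) (N : int) :
  p [set n | (N %| n)%Z] -> upow p k [set n | (N %| n)%Z].
Proof. by move=> hp; elim: k => [|k IH] /=; [exact: dvdz0|exact: uadd_dvd]. Qed.

(** The two linear terms cancel. For good [p] this supplies large, highly divisible integers n along
    which n c tends to 0 for every c at once. *)
Lemma tau_udiff1 (R : realType) (p : ultra int) (c : circle R) :
  tau (udiff 1 p) 1 c = 0.
Proof.
rewrite tau_udiffS !big_ord_recl big_ord0 /= tau0 /bump /=.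
by rewrite subnn subn0 tau0 expr0 expr1 mulr1z mulrN1z addr0 addNr.
Qed.

(* Raising z + s to the power M, for M drawn from an ultrafilter along which
   M c tends to 0 for every c, kills the lowest nonvanishing tau. *)
Lemma quasi_inverse (R : realType) (s : ultra int) (i : nat) :
  good s -> exists2 z, good z & zeros_below R (uadd z s) i.
Proof.
move=> gs; elim: i => [|i [z gz IH]].
  by exists s => // e c; rewrite ltn0 andbF.
have [i0|i0] := posnP i.
  by exists s => // e c; rewrite i0; case: e => [|[]].
pose P := uadd z s; pose u := udiff 1 s.
(* The exponent M - 1 is chosen so that z' + s becomes the M-th power of P = z + s; M is positive
   almost everywhere along u. *)
pose z' := ubind u (fun M : int => uadd (upow P `|M|.-1) z).
have gP : good P by exact: good_add.
have gu : good u by exact: good_udiff.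
exists z'.
  apply: good_bind => M; split=> N; first exact: uadd_tail.
  by move=> N0; apply: uadd_dvd; [apply: upow_dvd; exact: gP.2|exact: gz.2].
have E e (c : circle R) : tau (uadd z' s) e c =
    ulim u (fun M : int => tau (upow P `|M|) e c).
  rewrite /tau ulim_add ulim_bind; apply: ulim_ae; apply: uS (gu.1 0) => M /= M0.
  rewrite -[in RHS](prednK (n := `|M|%N)) ?absz_gt0 ?gt_eqF //= !ulim_add.
  apply: eq_ulim => a; rewrite ulim_add; apply: eq_ulim => b.
  by apply: eq_ulim => y; rewrite addrA.
move=> e c /andP[e0]; rewrite ltnS leq_eqVlt E => /orP[/eqP ->|ei].
  rewrite (@ulim_ae _ _ _ _ (fun M : int => tau P i c *~ M ^+ 1)).
    exact: tau_udiff1.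
  apply: uS (gu.1 0) => M /= M0; have [_ ->] := tau_upow `|M|%N IH => //.
  by rewrite expr1 pmulrn gtz0_abs.
rewrite (eq_ulim _ (g := fun=> 0)) ?ulim_cst // => M.
by have [-> //] := tau_upow `|M|%N IH; rewrite e0.
Qed.

(** * Prescribing the values of tau *)

Lemma lt_norm_mul (N n k : int) : `|N| < n -> 0 < k -> N < n * k.
Proof. by move=> Nn k0; have : n * 1 <= n * k; [rewrite ler_wpM2l //; lia|lia]. Qed.

(** A multiple n of N moves g to a small x, nonzero because g is not torsion; multiples of x then
    approximate s with error at most |x|. *)
Lemma kronecker (R : realType) (g s : circle R) (d : R) (N : int) :
  ~ torsion g -> 0 < d -> N != 0 ->
  exists n, [/\ N < n, (N %| n)%Z & small d (g *~ n - s)].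
Proof.
move=> ng d0 N0; have [p0 gp0] := good_exists.
have gu : good (udiff 1 p0) by exact: good_udiff.
have d1 : 0 < Num.min d 1 by rewrite lt_min d0 ltr01.
have := uI (ulimP (udiff 1 p0) (fun n => g *~ n ^+ 1) d1)
  (uI (gu.1 `|N|) (gu.2 N N0)).
rewrite -[ulim _ _]/(tau _ 1 g) tau_udiff1 => /u_ex[n [/= + [Nn dn]]].
rewrite subr0 expr1 => -[x gn xd].
have x0 : x != 0.
  apply: contra_notN ng => /eqP x0; exists n; last by rewrite gn x0 raddf0.
  by move: Nn; lia.
pose y := cval s; have /andP[y0 y1] : (0 <= y) && (y < 1) by exact: valP s.
move: xd; rewrite lt_min => /andP[xd]; rewrite ltr_norml => /andP[x1 x2].
(* The integer shift b of the target makes the quotient by x at least 1 for either sign of x, so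
   that its floor k is positive. *)
have [b qb] : exists b : int, 1 <= (y + b%:~R) / x.
  case: (ltgtP x 0) x0 => // xs _.
    by exists (-2); rewrite ler_ndivlMr // mul1r intrN; lra.
  by exists 1; rewrite ler_pdivlMr // mul1r; lra.
set q := (y + b%:~R) / x in qb; pose k := Num.floor q.
have k0 : 0 < k by rewrite floor_gt0.
have /andP[kq qk] := floor_itv q; rewrite -/k intrD in kq qk.
exists (n * k); split.
  exact: lt_norm_mul.
  by rewrite dvdz_mulr.
rewrite mulrzA gn tor_mulz -[s]tor_cval -/y -(torDz y b) -raddfB.
exists (x * k%:~R - (y + b%:~R)) => //; apply: le_lt_trans xd.
have -> : x * k%:~R - (y + b%:~R) = x * (k%:~R - q).
  by rewrite mulrBr /q [x * (_ / _)]mulrC divfK.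
rewrite normrM ler_piMr // ler_norml; apply/andP; split; lra.
Qed.

Lemma tail_inv (R : realType) (U : ultra nat) (d : R) :
  (forall N, U [set n | (N < n)%N]) -> 0 < d -> U [set i : nat | i.+1%:R^-1 <= d].
Proof.
move=> Ut d0; apply: uS (Ut (Num.bound d^-1)) => i /= hi.
rewrite -[d]invrK lef_pV2 ?posrE ?invr_gt0 //.
have := archi_boundP (ltW (_ : 0 < d^-1)); rewrite invr_gt0 => /(_ d0) h.
by rewrite (le_trans (ltW h)) // ler_nat ltnW // ltnW.
Qed.

Definition attains (R : realType) (a : nat) (g s : circle R) : Prop :=
  exists p, [/\ good p, zeros_below R p a & tau p a g = s].

(** Kronecker approximations of precision 1/(i + 1), divisible by i! and exceeding it, converge
    along [U] to a good ultrafilter. *)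
Lemma attains1 (R : realType) (g s : circle R) : ~ torsion g -> attains 1 g s.
Proof.
move=> ng; have [U Ut] := ultra_oo.
have H (i : nat) : exists n : int, [/\ (i`!)%:Z < n, ((i`!)%:Z %| n)%Z
    & small (i.+1%:R^-1 : R) (g *~ n - s)].
  by apply: kronecker; rewrite ?invr_gt0 ?ltr0n // eqz_nat -lt0n fact_gt0.
have [n nP] := choice H; exists (umap n U); split.
- split=> N.
    apply: uS (Ut `|N|%N) => i /= Ni; have [+ _ _] := nP i.
    by have := fact_geq i; lia.
  move=> N0; apply: uS (Ut `|N|%N) => i /= Ni; have [_ + _] := nP i.
  by apply: dvdz_trans; rewrite dvdzE /= dvdn_fact // absz_gt0 N0 ltnW.
- by move=> e c; case: e => [|[]].
rewrite /tau ulim_map; apply: ulim_eq => d d0.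
apply: uS (tail_inv Ut d0) => i /= hd; rewrite expr1.
by have [_ _] := nP i; exact: small_le.
Qed.

(** Torsion values are dense, and tau of a [ubind] is the limit of the tau of its members. *)
Lemma attains_closed (R : realType) (a : nat) (g : circle R) :
  (forall s, torsion s -> attains a g s) -> forall s, attains a g s.
Proof.
move=> H s; have [U Ut] := ultra_oo; pose y := cval s.
pose rho (k : nat) : R := (Num.floor (y * k.+1%:R))%:~R / k.+1%:R.
have k0 k : k.+1%:R != 0 :> R by rewrite pnatr_eq0.
have rt k : torsion (tor (rho k)).
  exists k.+1%:Z => //; rewrite tor_mulz; apply/tor_eq0.
  by exists (Num.floor (y * k.+1%:R)); rewrite -pmulrn divfK.
have [p pP] := choice (fun k => H _ (rt k)).
exists (ubind U p); split.
- by apply: good_bind => k; have [] := pP k.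
- move=> e c he; rewrite /tau ulim_bind (eq_ulim _ (g := fun=> 0)) ?ulim_cst //.
  by move=> k; have [_ + _] := pP k; exact.
rewrite /tau ulim_bind (eq_ulim _ (g := fun k => tor (rho k))); last first.
  by move=> k; have [_ _] := pP k.
apply: ulim_eq => d d0; apply: uS (tail_inv Ut d0) => k /= hd.
rewrite -[s]tor_cval -/y -raddfB; exists (rho k - y) => //.
apply: lt_le_trans hd; have /andP[h1 h2] := floor_itv (y * k.+1%:R).
have -> : rho k - y = ((Num.floor (y * k.+1%:R))%:~R - y * k.+1%:R) / k.+1%:R.
  by rewrite mulrBl mulfK.
rewrite normrM [`|k.+1%:R^-1|]ger0_norm ?invr_ge0 // gtr_pMl ?invr_gt0 //.
by rewrite ltr_norml; apply/andP; split; move: h1 h2; rewrite intrD; lra.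
Qed.

Lemma tau_add_lead_r (R : realType) (p q : ultra int) (e : nat) (c : circle R) :
  (0 < e)%N -> zeros_below R q e ->
  tau (uadd p q) e c = tau p e c + tau q e c.
Proof.
move=> e0 zq; rewrite tau_addE.
rewrite (big_ord_ends (F := fun i => tau p (e - i) (tau q i c) *+ 'C(e, i))) //.
  by rewrite bin0 binn !mulr1n subn0 subnn !tau0.
by move=> i ie; rewrite zq // tau_at0 mul0rn.
Qed.

(** One order above the leading one, a single mixed term survives. The next lemma yields the
    opposite composite when the right summand has the vanishing orders. *)
Lemma tau_add_next (R : realType) (p q : ultra int) (a : nat) (c : circle R) :
  (0 < a)%N -> zeros_below R p a ->
  tau (uadd p q) a.+1 c =
  tau p a.+1 c + tau p a (tau q 1 c) *+ a.+1 + tau q a.+1 c.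
Proof.
case: a => // a _ zp; rewrite tau_addE 2!big_ord_recl big_ord_recr /=.
rewrite big1 ?add0r => [|i _].
  rewrite /bump /= !add1n bin0 bin1 binn !mulr1n subn0 subn1 subnn !tau0.
  by rewrite addrA.
rewrite zp ?mul0rn // /bump /= !add1n; have := ltn_ord i; lia.
Qed.

Lemma tau_add_next_r (R : realType) (p q : ultra int) (a : nat) (c : circle R) :
  (0 < a)%N -> zeros_below R q a ->
  tau (uadd p q) a.+1 c =
  tau p a.+1 c + tau p 1 (tau q a c) *+ a.+1 + tau q a.+1 c.
Proof.
case: a => // a _ zq; rewrite tau_addE 2!big_ord_recr big_ord_recl /=.
rewrite big1 ?addr0 => [|i _].
  by rewrite bin0 binn binSn !mulr1n subn0 subSnn subnn !tau0.
by rewrite zq ?tau_at0 ?mul0rn // /bump /= !add1n ltnS ltn_ord.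
Qed.

Lemma torsionMn (R : realType) (g : circle R) (k : nat) :
  torsion (g *+ k.+1) -> torsion g.
Proof.
move=> [N N0 h]; exists (k.+1%:Z * N); first by rewrite mulf_neq0.
by rewrite mulrzA -pmulrn.
Qed.

Lemma torsionN (R : realType) (g : circle R) : torsion g -> torsion (- g).
Proof. by move=> [N N0 h]; exists N; rewrite // mulNrz h oppr0. Qed.

(* The sums p + q and q + p have the same tau up to order a, and their tau of
   order a + 1 differ by (a + 1) times the commutator of [tau p a] and [tau q 1].
   Cancelling q + p by a quasi-inverse leaves just that commutator. *)
Lemma attains_step (R : realType) (a : nat) (g s : circle R) : (0 < a)%N ->
  (forall g s : circle R, ~ torsion g -> attains a g s) ->
  ~ torsion g -> attains a.+1 g s.
Proof.
move=> a0 IH ng; move: s; apply: attains_closed => s ts.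
have ng' : ~ torsion (g *+ a.+1) by move=> /torsionMn.
(* At order a, p fixes (a + 1) g; at order 1, q sends it to -s. Since s is torsion, tau of p kills
   it, so one composite vanishes and the commutator is s. *)
have [p [gp zp pE]] := IH _ (g *+ a.+1) ng'.
have [q [gq _ qE]] := attains1 (- s) ng'.
have [z gz zz] := quasi_inverse R a.+2 (good_add gq gp).
have rs e (c : circle R) : (e <= a)%N -> tau (uadd p q) e c = tau (uadd q p) e c.
  case: e => [|e] ea; first by rewrite !tau0.
  have zpe := zeros_below_sub ea zp.
  by rewrite tau_add_lead // tau_add_lead_r // addrC.
exists (uadd z (uadd p q)); split; first by apply: good_add => //; exact: good_add.
  move=> e c /andP[e0 ea].
  have <- : tau (uadd z (uadd q p)) e c = 0.
    by apply: zz; rewrite e0 ltnS ltnW.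
  rewrite !tau_addE; apply: eq_bigr => i _; rewrite rs //.
  by rewrite (leq_trans (leq_ord i)) // -ltnS.
have /eqP : tau (uadd z (uadd q p)) a.+1 g = 0 by apply: zz; rewrite /= ltnS leqnn.
rewrite tau_addE big_ord_recr /= subnn tau0 binn mulr1n addr_eq0 => /eqP h.
rewrite tau_addE big_ord_recr /= subnn tau0 binn mulr1n.
rewrite (eq_bigr (fun i : 'I_a.+1 =>
  tau z (a.+1 - i) (tau (uadd q p) i g) *+ 'C(a.+1, i))); last first.
  by move=> i _; rewrite rs // -ltnS.
rewrite h.
rewrite (tau_add_next q g a0 zp) (tau_add_next_r q g a0 zp) -!tauMn pE qE.
rewrite (tau_torsion gp a0 (torsionN ts)) addr0 opprD opprD opprK.
by rewrite addrA subrK addrAC addNr add0r.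
Qed.

Lemma attainsP (R : realType) (a : nat) (g s : circle R) :
  (0 < a)%N -> ~ torsion g -> attains a g s.
Proof.
case: a => // a _; elim: a g s => [|a IH] g s ng; first exact: attains1.
by apply: attains_step.
Qed.

(** At order i the mixed terms of (y - x)^i vanish, and for even i the two pure terms add up,
    doubling the value at each step. *)
Lemma udiff_lead (R : realType) (p : ultra int) (i m : nat) :
  zeros_below R p i -> zeros_below R (udiff m p) i /\
  ((0 < i)%N -> ~~ odd i ->
    forall c : circle R, tau (udiff m p) i c = tau p i c *+ 2 ^ m).
Proof.
move=> zp; elim: m => [|m [IH1 IH2]]; first by split=> // _ _ c; rewrite expn0.
have E e (c : circle R) : (0 < e <= i)%N -> tau (udiff m.+1 p) e c =
    tau (udiff m p) e c *~ (-1) ^+ e + tau (udiff m p) e c.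
  move=> /andP[e0 ei]; rewrite tau_udiffS.
  rewrite (big_ord_ends (F := fun i => tau (udiff m p) (e - i)
    (tau (udiff m p) i c) *~ (-1) ^+ (e - i) *+ 'C(e, i))) //.
    by rewrite bin0 binn !mulr1n subn0 subnn !tau0 expr0 mulr1z.
  move=> j /andP[j0 je]; rewrite [tau _ j c]IH1 ?tau_at0 ?mul0rz ?mul0rn //.
  by rewrite j0 (leq_trans je).
split=> [e c /andP[e0 ei]|i0 ei c].
  by rewrite E ?e0 ?(ltnW ei) // IH1 ?e0 // mul0rz addr0.
rewrite E ?i0 ?leqnn // IH2 // -signr_odd (negbTE ei) expr0 mulr1z.
by rewrite -mulr2n -mulrnA -expnSr.
Qed.

Lemma udiff_odd_tau (R : realType) (p : ultra int) (t : nat) :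
  (forall e (c : circle R), odd e -> (e < t)%N -> tau p e c = 0) ->
  forall m e (c : circle R), odd e -> (e < t + 2 * m)%N ->
    tau (udiff m p) e c = 0.
Proof.
move=> zp m e c oe et.
apply: (udiff_odd _ (chi := fun n => c *~ n) _ oe et).
  move=> chi hchi e' oe' et'; rewrite -(zp e' (chi 1) oe' et').
  by apply: eq_ulim => n; exact: is_add_int.
by move=> a b; rewrite mulrzDr.
Qed.

(** The witness 1/(2K) has the class of 1/2 as its K-th multiple. *)
Lemma torsion_neq0 (R : realType) (K : int) :
  K != 0 -> exists2 h : circle R, torsion h & h *~ K <> 0.
Proof.
move=> K0; have K0' : K%:~R != 0 :> R by rewrite intr_eq0.
exists (tor (2 * K%:~R)^-1).
  exists (2 * K); first by rewrite mulf_neq0.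
  rewrite tor_mulz; apply/tor_eq0; exists 1.
  by rewrite intrM mulVf // mulf_neq0 ?pnatr_eq0.
rewrite tor_mulz invfM -mulrA mulVf // mulr1 => /tor_eq0[m hm].
have : (2 * m)%:~R = 1%:~R :> R by rewrite intrM -hm mulfV ?pnatr_eq0.
by move=> /intr_inj; lia.
Qed.

Lemma circle_divisible (R : realType) (t : circle R) (n : nat) :
  (0 < n)%N -> exists s, s *+ n = t.
Proof.
move=> n0; exists (tor (cval t / n%:R)); rewrite -raddfMn /= -[X in tor X]mulr_natr.
by rewrite divfK ?tor_cval // pnatr_eq0 -lt0n.
Qed.

(** A first ultrafilter r gives the value at order t. Adding w, a t-fold difference, corrects order
    2 and leaves the odd orders up to t unchanged; the factor 2^t it introduces is divided out
    beforehand. *)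
Lemma odd_design (R : realType) (g h : circle R) (t : nat) :
  odd t -> ~ torsion g -> exists p, [/\ good p,
    forall e (c : circle R), odd e -> (e < t)%N -> tau p e c = 0,
    tau p t g = h & tau p 2 g = g].
Proof.
move=> ot ng; have t0 : (0 < t)%N by case: (t) ot.
have [r [gr zr rE]] := attainsP h t0 ng.
pose rho := g - tau r 2 g.
have [s sE] : exists s, s *+ 2 ^ t = rho by apply: circle_divisible; rewrite expn_gt0.
have [q [gq zq qE]] := attainsP s (isT : (0 < 2)%N) ng.
pose w := udiff t q; have gw : good w by exact: good_udiff.
have w2 : tau w 2 g = rho.
  by have [_ ->] := udiff_lead t zq; rewrite // qE sE.
have wo e (c : circle R) : odd e -> (e <= t)%N -> tau w e c = 0.
  by move=> oe et; apply: (@udiff_odd_tau _ _ 0) => //; lia.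
have E e (c : circle R) : odd e -> (e <= t)%N -> tau (uadd r w) e c = tau r e c.
  move=> oe et; rewrite tau_addE big_ord_recl big1 => [|i _].
    by rewrite /= bin0 mulr1n subn0 tau0 addr0.
  have := ltn_ord i; rewrite /= /bump /= add1n => ie.
  (* In a mixed term, either w has odd order and vanishes, or r has a positive order below t and
     vanishes. *)
  have [oi|ei] := boolP (odd i.+1).
    by rewrite wo ?tau_at0 ?mul0rn // (leq_trans _ et).
  rewrite zr ?mul0rn // subn_gt0 ltn_neqAle ie andbT.
  apply/andP; split; first by apply: contraNneq ei => ->.
  by move: et ie; clear; lia.
exists (uadd r w); split; first exact: good_add.
- move=> e c oe et; rewrite E ?(ltnW et) // zr // et andbT; by case: (e) oe.
- by rewrite E.
rewrite tau_addE !big_ord_recr big_ord0 /= add0r subn0 subnn !tau0 bin0 binn.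
by rewrite !mulr1n wo // tau_at0 mul0rn addr0 w2 addrC subrK.
Qed.

(** * Necessity *)

Lemma torsionMz (R : realType) (g : circle R) (m : int) :
  torsion g -> torsion (g *~ m).
Proof.
by move=> [N N0 h]; exists N => //; rewrite -mulrzA mulrC mulrzA h mul0rz.
Qed.

(* With tau of order 2 fixing g and torsion elements killed by every tau, only
   the term x^n y^2 survives in the expansion of (y - x)^(n + 2), n = t + 2 l. *)
Lemma odd_lead (R : realType) (t : nat) : odd t -> forall l : nat,
  exists2 K : int, K != 0 & forall (p : ultra int) (g : circle R), good p ->
    (forall e (c : circle R), odd e -> (e < t)%N -> tau p e c = 0) ->
    torsion (tau p t g) -> tau p 2 g = g ->
    tau (udiff l p) 2 g = g *+ 2 ^ l /\
    tau (udiff l p) (t + 2 * l) g = tau p t g *~ K.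
Proof.
move=> ot; elim=> [|l [K K0 IH]].
  exists 1 => // p g gp zp tp p2; rewrite /= p2 muln0 addn0.
  by split; rewrite ?expn0 ?mulr1z.
(* The new constant collects the sign of x^n, n being odd, the factor 2^l from order 2, and the
   binomial coefficient of x^n y^2. *)
pose n := (t + 2 * l)%N; exists (- (K * (2 ^ l)%:Z * 'C(n.+2, 2)%:Z)).
  by rewrite oppr_eq0 !mulf_neq0 ?eqz_nat // -lt0n ?expn_gt0 // bin_gt0.
move=> p g gp zp tp p2; have [W2 Wn] := IH p g gp zp tp p2.
have on : odd n by rewrite oddD ot mul2n odd_double.
have Wo := udiff_odd_tau zp (m := l).
have gW : good (udiff l p) by exact: good_udiff.
have W11 : tau (udiff l p) 1 (tau (udiff l p) 1 g) = 0.
  have [n1|n1] := eqVneq n 1%N; last first.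
    by rewrite Wo //; move: n1 on; rewrite -/n; case: (n) => [|[]].
  rewrite [X in tau _ 1 X](_ : _ = tau p t g *~ K); last by rewrite -Wn -/n n1.
  by apply: tau_torsion => //; exact: torsionMz.
split.
  rewrite tau_udiffS !big_ord_recr big_ord0 /= W11 !tau0 W2 subn0 subnn.
  rewrite mul0rz mul0rn add0r addr0 expr0 sqrrN expr1n mulr1z bin0 binn.
  by rewrite !mulr1n -mulr2n -mulrnA -expnSr.
have -> : (t + 2 * l.+1 = n.+2)%N by rewrite /n; lia.
rewrite tau_udiffS.
pose F i := tau (udiff l p) (n.+2 - i) (tau (udiff l p) i g)
  *~ (-1) ^+ (n.+2 - i) *+ 'C(n.+2, i).
rewrite -[LHS]/(\sum_(i < n.+3) F i).
have FE : F n.+2 = - F 0%N.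
  rewrite /F bin0 binn !mulr1n subnn subn0 !tau0 expr0 mulr1z -signr_odd /= on.
  by rewrite expr1 mulrN1z opprK.
(* Here i is the exponent of y. For i = n the inner value is torsion; for other odd i it is 0; for
   even i other than 2 the outer tau has odd order below n. *)
have F0 i : (0 < i < n.+2)%N -> i != 2 -> F i = 0.
  move=> /andP[i0 il] i2; rewrite /F.
  have [oi|ei] := boolP (odd i).
    have [->|inn] := eqVneq i n.
      by rewrite Wn tau_torsion ?mul0rz ?mul0rn //; [rewrite subn_gt0|exact: torsionMz].
    rewrite [tau _ i g]Wo // ?tau_at0 ?mul0rz ?mul0rn //.
    by rewrite -/n; move: oi on inn il; clear; lia.
  rewrite Wo ?mul0rz ?mul0rn //.
    by rewrite oddB ?(ltnW il) //= on negbK (negbTE ei).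
  by rewrite -/n; move: ei i2 i0 il; clear; lia.
have n0 : (0 < n)%N by case: (n) on.
rewrite big_ord_recr big_ord_recl /= FE addrC addKr.
rewrite (bigD1 (Ordinal (n0 : (1 < n.+1)%N))) //= big1 ?addr0; last first.
  move=> i i1; apply: F0; first by rewrite /bump /= add1n ltnS ltn_ord.
  by apply: contraNneq i1 => h; apply/eqP/val_inj; move: h; rewrite /bump /=; lia.
rewrite /bump /F /= add1n !subSS subn0 W2 tauMn Wn -signr_odd on expr1 mulrN1z.
by rewrite mulrNz !mulrzA -!pmulrn mulNrn.
Qed.

Lemma ultra_eq (I : Type) (p q : ultra I) :
  (forall A, p A <-> q A) -> p = q.
Proof.
case: p q => [p ? ? ? ? ?] [q ? ? ? ? ?] /= h.
have e : p = q by apply/funext => A; apply/propext; exact: h.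
by subst q; congr Ultra; exact: Prop_irrelevance.
Qed.

(** Draw from p an increasing sequence on whose differences v stays close to its limit along D_l p.
    By (iii) some such difference brings v close to 0. *)
Lemma Delta_star_ulim (R : realType) (l : nat) (v : {poly R}) (p : ultra int) :
  (forall eps : R, 0 < eps -> is_Delta_star l (ret_set v eps)) -> good p ->
  \sum_(i < (size v).+1) tau (udiff l p) i (tor v`_i) = 0.
Proof.
(* The extra zero term keeps index 0 in range even for v = 0. *)
move=> Hv gp; rewrite big_ord_recr /= nth_default // raddf0 tau_at0 addr0.
have <- : ulim (udiff l p) (fun n => tor v.[n%:~R]) =
    \sum_(i < size v) tau (udiff l p) i (tor v`_i).
  under eq_ulim do rewrite tor_horner.
  by rewrite (ulim_sum _ _ (fun i n => tor v`_i *~ n ^+ i)).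
apply: small_eq0 => d d0; have d20 : 0 < d / 2 by rewrite divr_gt0.
have pE : umap id p = p by apply: ultra_eq.
have := ulimP (udiff l p) (fun n => tor v.[n%:~R]) d20.
rewrite -[X in udiff l X]pE.
pose lt (i j : int) := i < j /\ 0 < j.
have ptail i : p [set k | lt i k].
  by apply: uS (uI (gp.1 i) (gp.1 0)) => k [].
move=> /(udiff_sequence ptail)[e [e_lt eP]].
(* The shift drops e 0, the only term not known to be positive. *)
have [_ /(_ (fun k => e k.+1))] := Hv _ d20; case.
- by move=> k; have [] := e_lt _ _ (ltn0Sn k).
- by move=> i j ij; have [] := e_lt i.+1 j.+1 ij.
move=> x [[_ /dist_int_small h1] [js [szj sj] ejs]].
have := eP (map succn js); rewrite size_map -map_comp /= pE.
rewrite -pdiffE => h2.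
have sjS : sorted ltn (map succn js).
  exact: (homo_sorted (f := succn) (e := ltn) (e' := ltn) (fun i j => id) js sj).
have {h2} h2 := h2 sjS szj.
move: h2; rewrite -[map _ js]/(map (fun k => e k.+1) js) ejs => /smallN h2.
by have := small_half h1 h2; rewrite opprB addrC subrK.
Qed.

Lemma downward_ind (P : nat -> Prop) (n : nat) :
  (forall i, (n <= i)%N -> P i) ->
  (forall j, (forall i, (j < i)%N -> P i) -> P j) -> forall i, P i.
Proof.
move=> Pn step; suff H k i : (n <= i + k)%N -> P i by move=> i; apply: (H n); lia.
elim: k i => [|k IH] i; first by rewrite addn0; exact: Pn.
by move=> ni; apply: step => j ij; apply: IH; lia.
Qed.

Lemma torsion0 (R : realType) : torsion (0 : circle R).
Proof. by exists 1; rewrite ?mul0rz. Qed.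

Lemma Delta_star_coef_cond (R : realType) (l : nat) (v : {poly R}) :
  (0 < l)%N -> (forall eps : R, 0 < eps -> is_Delta_star l (ret_set v eps)) ->
  coef_cond l v.
Proof.
move=> l0 Hv; have [s gs] := good_exists.
have v0 : tor v`_0 = 0.
  (* With all tau of orders 1 to [size v] vanishing, only the constant coefficient contributes. *)
  have [z gz zz] := quasi_inverse R (size v).+1 gs.
  have := Delta_star_ulim Hv (good_add gz gs).
  rewrite big_ord_recl big1 ?addr0 ?tau0 // => i _.
  have [zd _] := udiff_lead l zz; rewrite zd //= /bump /= add1n ltnS.
  exact: ltn_ord.
have sz i : (size v <= i)%N -> torsion (tor v`_i).
  by move=> hi; rewrite nth_default // raddf0; exact: torsion0.
have lt_sz i : ~ torsion (tor v`_i) -> (i < (size v).+1)%N.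
  by move=> ni; rewrite ltnNge; apply/negP => hi; apply/ni/sz/ltnW.
have ev i : ~~ odd i -> (0 < i)%N -> torsion (tor v`_i).
  move: i; apply: (@downward_ind _ (size v)) => [i hi _ _|j IH ej j0]; first exact: sz.
  (* Let j be the highest bad even degree. Taking m extra differences makes the odd tau vanish
     beyond the degree of v, so the limit is 2^(l + m) h, which is nonzero. *)
  apply: contrapT => nj; set m := size v.
  have [h th hK] : exists2 h : circle R, torsion h & h *~ (2 ^ (l + m))%:Z <> 0.
    by apply: torsion_neq0; rewrite eqz_nat -lt0n expn_gt0.
  have [r [gr zr rE]] := attainsP h j0 nj.
  have := Delta_star_ulim Hv (good_udiff m gr); rewrite udiffD.
  have [zd dj] := udiff_lead (l + m) zr.
  rewrite (bigD1 (Ordinal (lt_sz _ nj))) //= dj // rE big1 ?addr0 // => i ij.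
  have [i0|i0] := posnP i; first by rewrite i0 v0 tau_at0.
  have [oi|ei] := boolP (odd i).
    apply: (@udiff_odd_tau _ _ 0) => //.
    by have := ltn_ord i; rewrite ltnS -/m; move: l0; clear; lia.
  have [lij|lji] := ltnP i j; first by apply: zd; rewrite i0.
  apply: tau_torsion => //; first exact: good_udiff.
  by apply: IH => //; rewrite ltn_neqAle lji andbT eq_sym.
have od i : odd i -> (2 * l <= i)%N -> torsion (tor v`_i).
  move: i; apply: (@downward_ind _ (size v)) => [i hi _ _|j IH oj lj]; first exact: sz.
  (* Even degrees and odd degrees above j have torsion coefficients, or are constant, and odd tau
     below j = t + 2l vanish. Only degree j survives, with value K h, which is nonzero. *)
  apply: contrapT => nj; pose t := (j - 2 * l)%N.
  have ot : odd t by rewrite oddB // oj mul2n odd_double.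
  have jE : (t + 2 * l = j)%N by rewrite subnK.
  have [K K0 HK] := odd_lead R ot l.
  have [h th hK] := torsion_neq0 R K0.
  have [p [gp zp pt p2]] := odd_design h ot nj.
  have tp : torsion (tau p t (tor v`_j)) by rewrite pt.
  have [_] := HK p _ gp zp tp p2; rewrite jE pt => Wj.
  have := Delta_star_ulim Hv gp.
  rewrite (bigD1 (Ordinal (lt_sz _ nj))) //= Wj big1 ?addr0 // => i ij.
  have [i0|i0] := posnP i; first by rewrite i0 v0 tau_at0.
  have [oi|ei] := boolP (odd i); last first.
    by apply: tau_torsion => //; [exact: good_udiff|exact: ev].
  have [lij|lji] := ltnP i j.
    by apply: (udiff_odd_tau zp) => //; rewrite jE.
  apply: tau_torsion => //; first exact: good_udiff.
  by apply: IH; rewrite ?(leq_trans lj) // ltn_neqAle lji andbT eq_sym.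
split=> // i i0 /orP[ei|li]; first exact: ev.
by have [oi|ei] := boolP (odd i); [exact: od|exact: ev].
Qed.

Theorem theorem5p1 (R : realType) (l : nat) (hl : (1 <= l)%N) (v : {poly R}) :
  ((exists w : {poly rat},
      [/\ w.[0] \is a Num.int,
          odd_poly_form (v - map_poly ratr w)
        & (size (v - map_poly ratr w)%R <= 2 * l)%N])
   <->
   (forall eps : R, 0 < eps ->
      exists r : nat, (2 ^ l <= r)%N /\ is_Delta_fin_star l r (ret_set v eps)))
  /\
  ((forall eps : R, 0 < eps ->
      exists r : nat, (2 ^ l <= r)%N /\ is_Delta_fin_star l r (ret_set v eps))
   <->
   (forall eps : R, 0 < eps -> is_Delta_star l (ret_set v eps))).
Proof.
have i_ii : coef_cond l v -> forall eps : R, 0 < eps ->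
    exists r : nat, (2 ^ l <= r)%N /\ is_Delta_fin_star l r (ret_set v eps).
  by move=> cv eps; exact: coef_cond_Delta_fin_star.
have ii_iii : (forall eps : R, 0 < eps -> exists r : nat,
      (2 ^ l <= r)%N /\ is_Delta_fin_star l r (ret_set v eps)) ->
    forall eps : R, 0 < eps -> is_Delta_star l (ret_set v eps).
  by move=> H eps /H[r [_]]; exact: Delta_fin_star_Delta_star.
have iii_i := @Delta_star_coef_cond R l v hl.
split; split.
- by move=> /coef_condP; exact: i_ii.
- by move=> /ii_iii/iii_i/coef_condP.
- exact: ii_iii.
- by move=> /iii_i; exact: i_ii.
Qed.
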